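(* For all $l,r\in H'$ and $\sigma\in\mathbb{R}^n_+$, with $\mathcal F_{l,r}(\sigma):=r(u_\sigma^l)$ and $F_{l,r}(\sigma):=r(\tilde u_\sigma^l)$, we have for $i=1,\ldots,n$ that $$\mathcal F_{l,r}(\sigma)-F_{l,r}(\sigma)=b_\sigma(u_\sigma^l-\tilde u_\sigma^l,\,u_\sigma^r-\tilde u_\sigma^r),$$ $$\frac{\partial}{\partial\sigma_i}\mathcal F_{l,r}(\sigma)-\frac{\partial}{\partial\sigma_i}F_{l,r}(\sigma)=b_i(\tilde u_\sigma^l,\,\tilde u_\sigma^r-u_\sigma^r)+b_i(\tilde u_\sigma^l-u_\sigma^l,\,u_\sigma^r).$$ Hence, by the Céa lemma, $$0\le\mathcal F_{l,r}(\sigma)-F_{l,r}(\sigma)\le C_\sigma\|u_\sigma^l-\tilde u_\sigma^l\|\,\|u_\sigma^r-\tilde u_\sigma^r\|\le\frac{C_\sigma^3}{\beta_\sigma^2}\inf_{v\in V}\|u_\sigma^l-v\|\,\inf_{v\in V}\|u_\sigma^r-v\|,$$ and $$\left|\frac{\partial}{\partial\sigma_i}\mathcal F_{l,r}(\sigma)-\frac{\partial}{\partial\sigma_i}F_{l,r}(\sigma)\right|\le C_i\|\tilde u_\sigma^l\|\,\|\tilde u_\sigma^r-u_\sigma^r\|+C_i\|u_\sigma^r\|\,\|\tilde u_\sigma^l-u_\sigma^l\|$$ $$\le\frac{C_iC_\sigma}{\beta_\sigma}\left(\|\tilde u_\sigma^l\|\inf_{v\in V}\|u_\sigma^r-v\|+\|u_\sigma^r\|\inf_{v\in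 V}\|u_\sigma^l-v\|\right).$$
   Context: Setting: $H$ is a real Hilbert space and $H'=\mathcal L(H,\mathbb{R})$ is its dual. Let $n\in\mathbb{N}$ and let $b_0,b_1,\ldots,b_n:\ H\times H\to\mathbb{R}$ be bounded, symmetric and positive semidefinite bilinear forms. For $\sigma=(\sigma_1,\ldots,\sigma_n)\in\mathbb{R}^n$ set $$b_\sigma(u,v):=b_0(u,v)+\sum_{i=1}^n\sigma_i\, b_i(u,v).$$ With $\mathbf 1:=(1,\ldots,1)^T\in\mathbb{R}^n$, it is assumed that there are constants $\beta,C>0$ with $C\|v\|^2\ge b_{\mathbf 1}(v,v)\ge\beta\|v\|^2$ for all $v\in H$. $\mathbb{R}^n_+$ denotes the set of all $\sigma\in\mathbb{R}^n$ with all entries strictly positive; for such $\sigma$ the form $b_\sigma$ is symmetric, bounded and coercive. Set $$C_\sigma:=C\max\{1,\sigma_1,\ldots,\sigma_n\},\qquad\beta_\sigma:=\beta\min\{1,\sigma_1,\ldots,\sigma_n\},$$ which are continuity and coercivity constants of $b_\sigma$, and let $C_i>0$ be the continuity constant of $b_i$, i.e. $|b_i(u,v)|\le C_i\|u\|\|v\|$ for all $u,v\in H$. Let $V\subset H$ be a finite-dimensional subspace (the finite element space). For $\sigma\in\mathbb{R}^n_+$ and $l\in H'$ (and likewise $r\in H'$), $u_\sigma^l\in H$ denotes the unique solution of $b_\sigma(u_\sigma^l,v)=l(v)$ for all $v\in H$, and $\tilde u_\sigma^l\in V$ denotes the unique solution of $b_\sigma(\tilde u_\sigma^l,v)=l(v)$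 for all $v\in V$. The Céa lemma states that $\|u_\sigma^l-\tilde u_\sigma^l\|\le\frac{C_\sigma}{\beta_\sigma}\inf_{v\in V}\|u_\sigma^l-v\|$. Both $\mathcal F_{l,r}$ and $F_{l,r}$ are differentiable functions of $\sigma\in\mathbb{R}^n_+$.
   Formalization: The bound 0 ≤ 𝓕_{l,r}−F_{l,r} fails for general l, r (take V={0}, r=−l≠0); it is stated only for l=r, and for all l, r the upper bounds are proved for the absolute value |𝓕_{l,r}(σ)−F_{l,r}(σ)|. *)

(* Defs.v *)
From mathcomp Require Export all_boot all_order all_algebra.
From mathcomp Require Export all_classical all_reals all_analysis.
Export Order.TTheory GRing.Theory Num.Theory numFieldNormedType.Exports.

Set Implicit Arguments.
Unset Strict Implicit.
Unset Printing Implicit Defensive.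

#[export] Set Implicit Arguments.
#[export] Unset Strict Implicit.
#[export] Unset Printing Implicit Defensive.

#[global] Open Scope classical_set_scope.
#[global] Open Scope ring_scope.

Section Definitions.
Context {R : realType} {H : completeNormedModType R}.

(* A complete normed space H carrying a positive definite symmetric form ip
   with this property is a real Hilbert space with inner product ip. *)
Definition norm_from_dot (ip : {dot H for idfun}) : Prop :=
  forall v : H, ip v v = `|v| ^+ 2.

Definition bounded_form (a : H -> H -> R) : Prop :=
  exists M : R, forall u v : H, `|a u v| <= M * `|u| * `|v|.

Definition psd_form (a : H -> H -> R) : Prop := forall v : H, 0 <= a v v.

Definition finite_dim_subspace (V : set H) : Prop :=
  exists (m : nat) (e : 'I_m -> H),
    V = range (fun c : 'I_m -> R => \sum_(j < m) c j *: e j).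

(* The solution u \in W of a(u, v) = l(v) for all v \in W. If a is a bounded
   coercive form, l a bounded functional and W a closed subspace, then it
   exists and is unique, so that the choice made by get is immaterial. *)
Definition solution (a : H -> H -> R) (W : set H) (l : H -> R) : H :=
  get [set u | W u /\ forall v, W v -> a u v = l v].

Definition best_approx (V : set H) (u : H) : R := inf [set `|u - v| | v in V].

Context {n : nat}.

Definition pos_vec (sigma : 'cV[R]_n) : Prop := forall i, 0 < sigma i 0.

Definition form_sigma (b0 : H -> H -> R) (b : 'I_n -> H -> H -> R)
  (sigma : 'cV[R]_n) (u v : H) : R :=
  b0 u v + \sum_(i < n) sigma i 0 * b i u v.

Definition cont_const (C : R) (sigma : 'cV[R]_n) : R :=
  C * \big[Num.max/1]_(i < n) sigma i 0.

Definition coer_const (beta : R) (sigma : 'cV[R]_n) : R :=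
  beta * \big[Num.min/1]_(i < n) sigma i 0.

(* sigma |-> r(u), where u \in W solves b_sigma(u, v) = l(v) for all v \in W.
   W = setT gives \mathcal F_{l,r}, and the finite element space W = V gives
   F_{l,r}. *)
Definition measurement (b0 : H -> H -> R) (b : 'I_n -> H -> H -> R)
  (W : set H) (l r : H -> R) (sigma : 'cV[R]_n) : R :=
  r (solution (form_sigma b0 b sigma) W l).

Definition partial (i : 'I_n) (F : 'cV[R]_n -> R) (sigma : 'cV[R]_n) : R :=
  'D_(delta_mx i 0) F sigma.

Definition has_partial (i : 'I_n) (F : 'cV[R]_n -> R) (sigma : 'cV[R]_n) :=
  derivable F sigma (delta_mx i 0).

End Definitions.

(* Main.v *)
Require Import Defs.
From HB Require Import structures.
From mathcomp Require Import ring lra.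

(* Let e = u^l - tilde u^l. Since r(v) = b_sigma(u^r, v), the error of the
   measurement is b_sigma(e, u^r), and Galerkin orthogonality lets one subtract
   tilde u^r in the second argument. For the derivatives, let u_h solve the
   problem on W (W = H or W = V) for sigma + h e_i. Subtracting the equations
   gives b_sigma(u_h - u_0, v) = - h b_i(u_h, v) on W; testing with the solution
   w for r shows that the difference quotient is - b_i(u_h, w), which tends to
   - b_i(u_0, w) because coercivity gives |u_h - u_0| = O(h).
   Solutions exist on V because the Gram system is solvable, and on H because a
   minimizing sequence of a(v, v) - 2 l(v) is Cauchy. *)

(** A quadratic without sign change has nonpositive discriminant. This yields both Cauchy-Schwarz
    and the residual estimate for almost minimizers. *)
Lemma discr_le_of_quadratic_ge0 (R : rcfType) (p q s : R) :
  (forall t, 0 <= p + 2 * t * q + t ^+ 2 * s) -> q ^+ 2 <= p * s.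
Proof.
move=> pqs_ge0; pose P := Poly [:: p; 2 * q; s].
have P_ge0 x : 0 <= P.[x].
  by rewrite horner_Poly /=; move: (pqs_ge0 x); congr (_ <= _); ring.
have := deg_le2_poly_ge0 (size_Poly _ : (size P <= 3)%N) P_ge0.
by rewrite !coef_Poly /=; lra.
Qed.

Lemma linear_functionalP (R : realType) (U : lmodType R)
  (l : {linear U -> R^o}) (u v : U) (t : R) :
  l (u + t *: v) = l u + t * l v.
Proof. by rewrite linearD linearZ. Qed.

(** * Algebra of symmetric bilinear forms *)

Section SymmetricForms.
Context {R : realType} {U : lmodType R}.
Implicit Types (a : {symmetric U}) (u v w : U) (t : R).

Lemma form_symC a u v : a u v = a v u.
Proof. by rewrite hermC /= expr0 mul1r. Qed.

Lemma formZl a t u v : a (t *: u) v = t * a u v.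
Proof. by rewrite linearZl_LR. Qed.

Lemma formZr a t u v : a u (t *: v) = t * a u v.
Proof. by rewrite linearZr_LR. Qed.

Lemma form_quadratic a u v t :
  a (u + t *: v) (u + t *: v) = a u u + 2 * t * a u v + t ^+ 2 * a v v.
Proof.
rewrite linearDl !linearDr /= !formZl !formZr (form_symC a v u).
ring.
Qed.

End SymmetricForms.

(** * The weighted sum of forms as a symmetric bilinear form *)

Section FormSigma.
Context {R : realType} {H : completeNormedModType R} {n : nat}.
Variables (b0 : {symmetric H}) (b : 'I_n -> {symmetric H}).
Implicit Types sigma : 'cV[R]_n.

(** Together with [form_sigma_hermitian] this feeds the instances making [form_sigma b0 b sigma] a
    [{symmetric H}], so that the results on abstract symmetric forms apply to it. *)
Lemma form_sigma_bilinear sigma :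
  bilinear_for (GRing.Scale.Law.clone _ _ *%R _)
    (GRing.Scale.Law.clone _ _ (idfun \; *%R) _) (form_sigma b0 b sigma).
Proof.
have add (c x y : R) (f g : 'I_n -> R) :
    c * x + y + \sum_i (c * f i + g i) =
    c * (x + \sum_i f i) + (y + \sum_i g i).
  rewrite big_split /= -mulr_sumr; ring.
split=> [u'|u] c x y; rewrite /form_sigma /= -add; congr (_ + _).
- by rewrite linearPl.
- by apply: eq_bigr => i _; rewrite linearPl /=; ring.
- by rewrite linearPr.
- by apply: eq_bigr => i _; rewrite linearPr /=; ring.
Qed.

HB.instance Definition _ sigma := bilinear_isBilinear.Build R H H R _ _
  (form_sigma b0 b sigma) (form_sigma_bilinear sigma).

Lemma form_sigma_hermitian sigma u v :
  form_sigma b0 b sigma u v =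
  (-1) ^+ false * (idfun (form_sigma b0 b sigma v u)).
Proof.
rewrite expr0 mul1r /= /form_sigma form_symC; congr (_ + _).
by apply: eq_bigr => i _; rewrite form_symC.
Qed.

HB.instance Definition _ sigma := isHermitianSesquilinear.Build R H false idfun
  (form_sigma b0 b sigma) (form_sigma_hermitian sigma).

End FormSigma.

(** * Cauchy-Schwarz for positive semidefinite forms *)

Section PositiveForms.
Context {R : realType}.

Lemma form_Cauchy_Schwarz (U : lmodType R) (a : {symmetric U}) (u v : U) :
  (forall w, 0 <= a w w) -> a u v ^+ 2 <= a u u * a v v.
Proof.
move=> a_ge0; apply: discr_le_of_quadratic_ge0 => t.
by rewrite -form_quadratic.
Qed.

(** By Cauchy-Schwarz a bound on the diagonal extends off the diagonal with the same constant. *)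
Lemma psd_form_bound (H : normedModType R) (a : {symmetric H}) (K : R) :
  0 <= K -> (forall w, 0 <= a w w <= K * `|w| ^+ 2) ->
  forall u v, `|a u v| <= K * `|u| * `|v|.
Proof.
move=> K_ge0 aK u v; rewrite -(@ler_pXn2r _ 2) ?nnegrE ?mulr_ge0 //.
rewrite real_normK ?num_real //; apply: (le_trans (form_Cauchy_Schwarz _ _ _)).
  by move=> w; case/andP: (aK w).
have /andP[u1 u2] := aK u; have /andP[v1 v2] := aK v.
apply: (le_trans (ler_pM u1 v1 u2 v2)).
by rewrite le_eqVlt; apply/orP; left; apply/eqP; ring.
Qed.

End PositiveForms.

(** * Solvability: energy minimization on H, Gram systems on finite-dimensional spaces *)

Section Riesz.
Context {R : realType} {H : completeNormedModType R}.
Variables (a : {symmetric H}) (l : {linear H -> R^o}) (beta M L : R).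
Hypotheses (beta_gt0 : 0 < beta) (a_coer : forall v, beta * `|v| ^+ 2 <= a v v).
Hypotheses (a_le : forall u v, `|a u v| <= M * `|u| * `|v|).
Hypotheses (l_le : forall v, `|l v| <= L * `|v|).

(** The energy functional: its derivative at [u] along [v] is [2 * (a u v - l v)], as [J_perturb]
    shows, so its minimizers solve the equation. *)
Let J v : R := a v v - 2 * l v.

Let J_perturb u v t :
  J (u + t *: v) = J u + 2 * t * (a u v - l v) + t ^+ 2 * a v v.
Proof.
rewrite /J form_quadratic linear_functionalP; ring.
Qed.

(** Coercivity bounds [J v] below by a quadratic polynomial in the norm of [v]; completing the
    square gives the lower bound. *)
Let J_has_inf : has_inf (range J).
Proof.
split; first by exists (J 0), 0.
exists (- (L ^+ 2 / beta)) => _ [v _ <-].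
have := a_coer v; have := l_le v; rewrite ler_norml => /andP[_ lv av].
have : 0 <= beta^-1 * (beta * `|v| - L) ^+ 2.
  by rewrite mulr_ge0 ?sqr_ge0 // invr_ge0 ltW.
have -> : beta^-1 * (beta * `|v| - L) ^+ 2 =
    beta * `|v| ^+ 2 - 2 * (L * `|v|) + L ^+ 2 / beta.
  by field; rewrite gt_eqF.
rewrite /J; lra.
Qed.

Let a_ge0 v : 0 <= a v v.
Proof. by apply: le_trans (a_coer v); rewrite mulr_ge0 ?sqr_ge0 // ltW. Qed.

(* An almost minimizer of J almost solves the equation. *)
Let residual_le u e v :
  J u < inf (range J) + e -> (a u v - l v) ^+ 2 <= e * a v v.
Proof.
move=> Ju; apply: discr_le_of_quadratic_ge0 => t.
have : inf (range J) <= J (u + t *: v).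
  by apply: ge_inf; [case: J_has_inf|exists (u + t *: v)].
rewrite J_perturb; lra.
Qed.

(** The residuals of [u] and [u'] at [d = u - u'] differ by [a d d]. Hence [residual_le], used for
    both, bounds the square of [a d d] by [2 * (e + e') * a d d]; one factor cancels, and coercivity
    concludes. *)
Let almost_minimizers_close u u' e e' :
  J u < inf (range J) + e -> J u' < inf (range J) + e' ->
  beta * `|u - u'| ^+ 2 <= 2 * (e + e').
Proof.
move=> Ju Ju'; set d := u - u'.
apply: (le_trans (a_coer d)).
have := residual_le d Ju; have := residual_le d Ju'.
have -> : a u d = a d d + a u' d by rewrite /d linearBl /= subrK.
have := a_ge0 d; set q := a d d; set x := a u' d - l d.
rewrite (_ : q + a u' d - l d = q + x); last by rewrite /x; ring.
rewrite le_eqVlt => /orP[/eqP <-|q_gt0 xe xe'].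
  (* If [a d d = 0] nothing can be cancelled, but then positivity of [e] and [e'] suffices. *)
  have e_gt0 w z : J w < inf (range J) + z -> 0 < z.
    have : inf (range J) <= J w by apply: ge_inf; [case: J_has_inf|exists w].
    lra.
  by have := e_gt0 _ _ Ju; have := e_gt0 _ _ Ju'; lra.
rewrite -(ler_pM2r q_gt0).
(* This square equals [2 * (q + x) ^+ 2 + 2 * x ^+ 2 - q ^+ 2]. *)
have : 0 <= (q + 2 * x) ^+ 2 by exact: sqr_ge0.
lra.
Qed.

Lemma Riesz_symmetric : exists u, forall v, a u v = l v.
Proof.
have /choice[x xJ] (k : nat) : exists u, J u < inf (range J) + k.+1%:R^-1.
  have k_gt0 : 0 < k.+1%:R^-1 :> R by rewrite invr_gt0.
  by have [_ [u _ <-] ?] := inf_adherent k_gt0 J_has_inf; exists u.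
have x_cvg : cvg (x @ \oo).
  apply/cauchy_cvgP/cauchyP => e e_gt0.
  (* If two tolerances are below this threshold, twice their sum is below [beta * e ^+ 2], as
     [almost_minimizers_close] requires. *)
  have d_gt0 : 0 < beta * e ^+ 2 / 4.
    by rewrite divr_gt0 // mulr_gt0 // exprn_gt0.
  have [K _ KP] := near_infty_natSinv_lt (PosNum d_gt0).
  exists (x K); exists K => // k /= Kk.
  rewrite -ball_normE /ball_ /= -(@ltr_pXn2r _ 2) ?nnegrE // ?(ltW e_gt0) //.
  rewrite -(ltr_pM2l beta_gt0).
  apply: (le_lt_trans (almost_minimizers_close (xJ K) (xJ k))).
  have /= K1 := KP _ (leqnn K); have /= K2 := KP _ Kk.
  move: K1 K2; move: (K.+1%:R^-1) (k.+1%:R^-1) => y z; lra.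
exists (lim (x @ \oo)) => v; set u := lim _.
apply/eqP; rewrite -subr_eq0 -sqrf_eq0 eq_le sqr_ge0 andbT.
(* The residual of the limit splits into [a (u - x k) v] and the residual of [x k]. Its square is at
   most twice the sum of their squares; boundedness and [residual_le] supply the two terms of [K],
   each times [e]. *)
set K := 2 * (M * `|v|) ^+ 2 + 2 * a v v.
have K_ge0 : 0 <= K by rewrite addr_ge0 // mulr_ge0 ?sqr_ge0 //.
apply/ler_addgt0Pr => e0 e0_gt0; rewrite add0r.
have K1_gt0 : 0 < K + 1 by rewrite ltr_wpDl.
(* Dividing by [K + 1] is safe even when [K] vanishes, and still gives [K * e <= e0]. *)
pose e := e0 / (K + 1); have e_gt0 : 0 < e by rewrite divr_gt0.
suff /le_trans : (a u v - l v) ^+ 2 <= K * e.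
  apply; rewrite /e mulrCA ler_piMr ?(ltW e0_gt0) //.
  by rewrite ler_pdivrMr // mul1r lerDl.
have se_gt0 : 0 < Num.sqrt e by rewrite sqrtr_gt0.
have [k [xk ke]] : exists k, `|u - x k| <= Num.sqrt e /\ k.+1%:R^-1 < e.
  have /cvgrPdist_le /(_ _ se_gt0) N1 := x_cvg.
  have N2 := near_infty_natSinv_lt (PosNum e_gt0).
  by have [k [? ?]] := filter_ex (filterI N1 N2); exists k.
have Y : (a (x k) v - l v) ^+ 2 <= e * a v v.
  by apply: (le_trans (residual_le v (xJ k))); rewrite ler_wpM2r // ltW.
have : (a u v - a (x k) v) ^+ 2 <= (M * `|v|) ^+ 2 * e.
  rewrite -linearBl -(sqr_sqrtr (ltW e_gt0)) -exprMn -real_normK ?num_real //.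
  have M_ge0 : 0 <= M * `|v|.
    have [->|v0] := eqVneq v 0; first by rewrite normr0 mulr0.
    have := le_trans (normr_ge0 _) (a_le v v).
    by rewrite pmulr_lge0 // normr_gt0.
  rewrite ler_pXn2r ?nnegrE ?(mulr_ge0 M_ge0) ?sqrtr_ge0 //.
  apply: (le_trans (a_le _ _)).
  by rewrite -mulrA [`|_ - _| * _]mulrC mulrA ler_wpM2l.
move: Y; set p := a (x k) v; set q := a u v; set z : R := l v.
have : 0 <= (q - p - (p - z)) ^+ 2 by exact: sqr_ge0.
rewrite /K; lra.
Qed.

End Riesz.

(** The [e j] may be linearly dependent, so the Gram matrix [G] may be singular. The right-hand side
    still lies in its row space: coefficients [z] in the kernel of [G] give a combination on which
    [a] vanishes, hence the zero vector, and [l] vanishes there too. *)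
Lemma Gram_solvable (R : realType) (U : lmodType R) (a : {symmetric U})
  (l : {linear U -> R^o}) (m : nat) (e : 'I_m -> U) :
  (forall v, a v v = 0 -> v = 0) ->
  exists c : 'I_m -> R, forall c' : 'I_m -> R,
    a (\sum_j c j *: e j) (\sum_j c' j *: e j) = l (\sum_j c' j *: e j).
Proof.
move=> a_def; pose G := \matrix_(i, j) a (e i) (e j).
pose y : 'rV[R]_m := \row_j l (e j).
pose comb (c : 'I_m -> R) := \sum_j c j *: e j.
have combl c v : a (comb c) v = \sum_j c j * a (e j) v.
  by rewrite linear_sumlz; apply: eq_bigr => j _; rewrite /= formZl.
have l_comb c : l (comb c) = \sum_j c j * l (e j).
  by rewrite linear_sum; apply: eq_bigr => j _; rewrite linearZ.
have /submxP[D yD] : (y <= G)%MS.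
  rewrite submxE; apply/eqP/rowP => k; rewrite !mxE.
  pose z j := cokermx G j k.
  have Gz i : a (e i) (comb z) = 0.
    rewrite form_symC combl; have /matrixP/(_ i k) := mulmx_coker G.
    rewrite !mxE => Gk0; rewrite -[RHS]Gk0; apply: eq_bigr => j _.
    by rewrite mxE form_symC mulrC.
  have z0 : comb z = 0.
    by apply: a_def; rewrite combl big1 // => j _; rewrite Gz mulr0.
  have := l_comb z; rewrite z0 linear0 => l0; rewrite [RHS]l0.
  by apply: eq_bigr => j _; rewrite mxE mulrC.
exists (D 0) => c'; rewrite -/(comb _) -/(comb _) l_comb form_symC combl.
apply: eq_bigr => k _; congr (_ * _); rewrite form_symC combl.
have /rowP/(_ k) := yD; rewrite !mxE => ->.
by apply: eq_bigr => j _; rewrite mxE.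
Qed.

Lemma continuous_functional_bounded (R : realType) (H : normedModType R)
  (l : {linear H -> R^o}) : continuous l ->
  exists L : R, forall v, `|l v| <= L * `|v|.
Proof.
move=> l_cont; have /linear_boundedP := continuous_linear_bounded 0 (l_cont 0).
by move=> /filter_ex[L lL]; exists L.
Qed.

(** * Properties of the chosen solution and of best approximation *)

Section Solutions.
Context {R : realType} {H : completeNormedModType R}.
Implicit Types (a : {symmetric H}) (W : set H) (l : {linear H -> R^o}).

Definition subspace W := W 0 /\ forall t u v, W u -> W v -> W (u + t *: v).

(** [get] returns a default value on the empty set; this predicate ensures that [solution] really
    solves the problem. *)
Definition solvable a W l := exists u, W u /\ forall v, W v -> a u v = l v.

Lemma solution_in a W l : solvable a W l -> W (solution a W l).
Proof. by move=> /getPex[]. Qed.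

Lemma solutionE a W l v : solvable a W l -> W v ->
  a (solution a W l) v = l v.
Proof. by move=> /getPex[_]; exact. Qed.

Lemma subspaceB W u v : subspace W -> W u -> W v -> W (u - v).
Proof. by case=> _ Wlin Wu Wv; rewrite -scaleN1r; exact: Wlin. Qed.

Lemma finite_dim_subspaceP W : finite_dim_subspace W -> subspace W.
Proof.
move=> [m [e ->]]; split.
  by exists (fun=> 0) => //; rewrite big1 // => j _; rewrite scale0r.
move=> t _ _ [c _ <-] [c' _ <-]; exists (fun j => c j + t * c' j) => //.
rewrite scaler_sumr -big_split; apply: eq_bigr => j _.
by rewrite scalerDl scalerA.
Qed.

Lemma coercive_eq0 a (beta : R) v : 0 < beta ->
  (forall w, beta * `|w| ^+ 2 <= a w w) -> a v v = 0 -> v = 0.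
Proof.
move=> beta_gt0 a_coer av0; apply/eqP; rewrite -normr_eq0 -sqrf_eq0 eq_le.
by rewrite sqr_ge0 andbT -(pmulr_rle0 _ beta_gt0) -av0.
Qed.

Lemma finite_dim_solvable a W l (beta : R) : 0 < beta ->
  (forall v, beta * `|v| ^+ 2 <= a v v) -> finite_dim_subspace W ->
  solvable a W l.
Proof.
move=> beta_gt0 a_coer [m [e ->]].
have [c cE] := Gram_solvable l e (fun v => coercive_eq0 beta_gt0 a_coer).
by exists (\sum_j c j *: e j); split; [exists c|move=> _ [c' _ <-]].
Qed.

Lemma Lax_Milgram_symmetric a l (beta M : R) : 0 < beta ->
  (forall v, beta * `|v| ^+ 2 <= a v v) ->
  (forall u v, `|a u v| <= M * `|u| * `|v|) -> continuous l ->
  solvable a setT l.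
Proof.
move=> beta_gt0 a_coer a_le /continuous_functional_bounded[L l_le].
have [u uE] := Riesz_symmetric beta_gt0 a_coer a_le l_le.
by exists u.
Qed.

(** Passes from a bound against each [v] in [W] to one against the infimum. Nonemptiness excludes
    the conventional value 0 of [inf] on the empty set. *)
Lemma le_best_approx W (u : H) (x K : R) : 0 < K -> W !=set0 ->
  (forall v, W v -> x <= K * `|u - v|) -> x <= K * best_approx W u.
Proof.
move=> K_gt0 [w Ww] xK; rewrite -ler_pdivrMl //; apply: lb_le_inf.
  by exists `|u - w|, w.
by move=> _ [v Wv <-]; rewrite ler_pdivrMl //; exact: xK.
Qed.

(** * Galerkin orthogonality and the Cea lemma *)

Section Galerkin.
Variables (a : {symmetric H}) (V : set H) (l r : {linear H -> R^o}).
Variables (beta K : R).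
Hypotheses (V_sub : subspace V) (beta_gt0 : 0 < beta) (K_gt0 : 0 < K).
Hypotheses (a_coer : forall v, beta * `|v| ^+ 2 <= a v v).
Hypotheses (a_le : forall u v, `|a u v| <= K * `|u| * `|v|).
Hypotheses (solH : solvable a setT l) (solV : solvable a V l).

Let ul := solution a setT l.
Let tul := solution a V l.

Lemma Galerkin_orthogonality v : V v -> a (ul - tul) v = 0.
Proof. by move=> Vv; rewrite linearBl /= !solutionE ?subrr. Qed.

(** For [v] in [V] also [tul - v] is in [V], so orthogonality turns [a d d] into [a d (ul - v)] for
    the error [d]. Coercivity on one side and boundedness on the other leave a common factor, the
    norm of [d], to cancel. *)
Lemma Cea : `|ul - tul| <= K / beta * best_approx V ul.
Proof.
apply: le_best_approx; first by rewrite divr_gt0.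
  by exists 0; case: V_sub.
move=> v Vv; set d := ul - tul.
have [->|d0] := eqVneq d 0.
  by rewrite normr0 mulr_ge0 // ltW // divr_gt0.
have d_gt0 : 0 < `|d| by rewrite normr_gt0.
have dE : a d d = a d (ul - v).
  have -> : ul - v = d + (tul - v) by rewrite /d subrKA.
  have orth : a d (tul - v) = 0.
    apply: Galerkin_orthogonality; apply: subspaceB => //; exact: solution_in.
  by rewrite [RHS]linearDr /= orth addr0.
rewrite mulrAC ler_pdivlMr // -(ler_pM2r d_gt0).
have := le_trans (a_coer d) (ler_norm _); rewrite dE.
move=> /le_trans /(_ (a_le _ _)); lra.
Qed.

Lemma solution_diff_form (solHr : solvable a setT r) (solVr : solvable a V r) :
  r ul - r tul = a (ul - tul) (solution a setT r - solution a V r).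
Proof.
have orth := Galerkin_orthogonality (solution_in solVr).
by rewrite linearBr /= orth subr0 form_symC linearBr /= !(solutionE solHr).
Qed.

End Galerkin.
End Solutions.

(** * Coercivity, continuity and solvability for positive weights *)

Section FormSigmaEstimates.
Context {R : realType} {H : completeNormedModType R} {n : nat}.
Variables (b0 : {symmetric H}) (b : 'I_n -> {symmetric H}) (beta C : R).
Hypotheses (b0_psd : psd_form b0) (b_psd : forall i, psd_form (b i)).
Hypotheses (beta_gt0 : 0 < beta) (C_gt0 : 0 < C).
Hypothesis b1_bounds : forall v : H,
  beta * `|v| ^+ 2 <= form_sigma b0 b (const_mx 1) v v <= C * `|v| ^+ 2.

Let form1E v : form_sigma b0 b (const_mx 1) v v = b0 v v + \sum_i b i v v.
Proof.
by congr (_ + _); apply: eq_bigr => i _; rewrite mxE mul1r.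
Qed.

Lemma coer_const_gt0 (sigma : 'cV[R]_n) : pos_vec sigma -> 0 < coer_const beta sigma.
Proof. by move=> sigma_gt0; rewrite mulr_gt0 // lt_bigmin. Qed.

Lemma cont_const_gt0 (sigma : 'cV[R]_n) : 0 < cont_const C sigma.
Proof. by rewrite mulr_gt0 // (lt_le_trans ltr01) // bigmax_ge_id. Qed.

(** The minimum bounds every weight from below, including the weight 1 of [b0], so on the diagonal
    positivity of the forms allows comparison with the form of unit weights. *)
Lemma form_sigma_coercive sigma v : pos_vec sigma ->
  coer_const beta sigma * `|v| ^+ 2 <= form_sigma b0 b sigma v v.
Proof.
move=> sigma_gt0; rewrite /coer_const; set m := \big[_/_]_(_ < _) _.
have m_gt0 : 0 < m by rewrite lt_bigmin.
have /andP[b1 _] := b1_bounds v.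
rewrite mulrAC mulrC; apply: (@le_trans _ _ (m * (b0 v v + \sum_i b i v v))).
  by rewrite ler_wpM2l ?(ltW m_gt0) // -form1E.
rewrite mulrDr mulr_sumr lerD ?ler_sum //.
  by rewrite ler_piMl // bigmin_le_id.
by move=> i _; rewrite ler_wpM2r ?b_psd // bigmin_le_cond.
Qed.

Lemma form_sigma_psd sigma v : pos_vec sigma -> 0 <= form_sigma b0 b sigma v v.
Proof.
move=> sigma_gt0; rewrite addr_ge0 ?sumr_ge0 // => i _.
by rewrite mulr_ge0 ?(ltW (sigma_gt0 i)) // b_psd.
Qed.

(** By [psd_form_bound] the diagonal suffices, and there each weight, including the 1 of [b0], is at
    most the maximum. *)
Lemma form_sigma_bound sigma u v : pos_vec sigma ->
  `|form_sigma b0 b sigma u v| <= cont_const C sigma * `|u| * `|v|.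
Proof.
move=> sigma_gt0; apply: psd_form_bound; first exact/ltW/cont_const_gt0.
move=> w; rewrite form_sigma_psd //= /cont_const; set m := \big[_/_]_(_ < _) _.
have m_ge1 : 1 <= m by rewrite bigmax_ge_id.
have m_ge0 : 0 <= m := le_trans ler01 m_ge1.
have /andP[_ b1] := b1_bounds w.
rewrite mulrAC mulrC; apply: (@le_trans _ _ (m * (b0 w w + \sum_i b i w w))).
  rewrite mulrDr mulr_sumr lerD ?ler_sum //; first by rewrite ler_peMl.
  move=> i _; rewrite ler_wpM2r ?b_psd //.
  exact: (le_bigmax 1 (fun j => sigma j 0)).
by rewrite ler_wpM2l // -form1E.
Qed.

Lemma form_sigma_solvable sigma (l : {linear H -> R^o}) :
  pos_vec sigma -> continuous l -> solvable (form_sigma b0 b sigma) setT l.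
Proof.
move=> sigma_gt0; apply: Lax_Milgram_symmetric.
- exact: coer_const_gt0 sigma_gt0.
- by move=> v; exact: form_sigma_coercive.
- by move=> u v; exact: form_sigma_bound.
Qed.

Lemma form_sigma_finite_dim_solvable sigma V (l : {linear H -> R^o}) :
  pos_vec sigma -> finite_dim_subspace V ->
  solvable (form_sigma b0 b sigma) V l.
Proof.
move=> sigma_gt0; apply: finite_dim_solvable.
  exact: coer_const_gt0 sigma_gt0.
by move=> v; exact: form_sigma_coercive.
Qed.

End FormSigmaEstimates.

(** * Differentiation of the measurement with respect to one weight *)

Section Sensitivity.
Context {R : realType} {H : completeNormedModType R} {n : nat}.
Variables (b0 : {symmetric H}) (b : 'I_n -> {symmetric H}) (W : set H).
Variables (l r : {linear H -> R^o}) (sigma : 'cV[R]_n) (be Ki : R) (i : 'I_n).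
Hypotheses (W_sub : subspace W) (sigma_gt0 : pos_vec sigma).
Hypotheses (be_gt0 : 0 < be) (Ki_gt0 : 0 < Ki).
Hypothesis b_coer : forall v, be * `|v| ^+ 2 <= form_sigma b0 b sigma v v.
Hypothesis b_le : forall u v, `|b i u v| <= Ki * `|u| * `|v|.
Hypothesis sol_l :
  forall tau, pos_vec tau -> solvable (form_sigma b0 b tau) W l.
Hypothesis sol_r : solvable (form_sigma b0 b sigma) W r.

(** The summands stand in the order in which [shift sigma] unfolds in the difference quotient. *)
Let shifted (h : R) : 'cV[R]_n := h *: delta_mx i 0 + sigma.
Let u (h : R) := solution (form_sigma b0 b (shifted h)) W l.
Let u0 := solution (form_sigma b0 b sigma) W l.
Let w := solution (form_sigma b0 b sigma) W r.

Let shifted_pos (h : R) : `|h| < sigma i 0 -> pos_vec (shifted h).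
Proof.
move=> h_lt j; rewrite !mxE eqxx andbT.
have [->|_] := eqVneq j i; last by rewrite mulr0 add0r.
by rewrite mulr1 -ltrBlDr sub0r; case/ltr_normlP: h_lt => ? _; lra.
Qed.

Let form_shifted (h : R) x y : form_sigma b0 b (shifted h) x y =
  form_sigma b0 b sigma x y + h * b i x y.
Proof.
rewrite /form_sigma -addrA; congr (_ + _).
rewrite [LHS](bigD1 i) //= [X in _ = X + _](bigD1 i) //= !mxE !eqxx mulr1.
rewrite mulrDl [RHS]addrC addrA; congr (_ + _).
by apply: eq_bigr => j ji; rewrite !mxE (negPf ji) mulr0 add0r.
Qed.

Let increment_form (h : R) v : `|h| < sigma i 0 -> W v ->
  form_sigma b0 b sigma (u h - u0) v = - (h * b i (u h) v).
Proof.
move=> h_lt Wv; rewrite linearBl /=.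
have uh : form_sigma b0 b (shifted h) (u h) v = l v.
  exact: solutionE (sol_l (shifted_pos h_lt)) Wv.
have -> : form_sigma b0 b sigma u0 v = l v.
  exact: solutionE (sol_l sigma_gt0) Wv.
by rewrite -uh form_shifted opprD addNKr.
Qed.

Let increment_in (h : R) : `|h| < sigma i 0 -> W (u h - u0).
Proof.
move=> h_lt; apply: subspaceB => //; apply: solution_in.
  exact/sol_l/shifted_pos.
exact: sol_l.
Qed.

(** Test the increment equation with the increment [d] itself and bound the norm of [u h] by those
    of [u0] and [d]. For small [h] the [d] term is absorbed into half of the coercive side, whence
    the factor 2. *)
Let increment_le (h : R) : `|h| < sigma i 0 -> `|h| * Ki <= be / 2 ->
  `|u h - u0| <= `|h| * (2 * Ki / be * `|u0|).
Proof.
move=> h_lt hK; set d := u h - u0.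
have [->|d0] := eqVneq d 0.
  by rewrite normr0 !mulr_ge0 ?invr_ge0 // ltW.
have d_gt0 : 0 < `|d| by rewrite normr_gt0.
have := b_coer d; rewrite [X in _ <= X -> _]increment_form //; last first.
  exact: increment_in.
move=> /le_trans /(_ (ler_norm _)); rewrite normrN normrM => dE.
have : be * `|d| <= `|h| * Ki * (`|u0| + `|d|).
  rewrite -(ler_pM2r d_gt0) -[be * _ * _]mulrA -expr2; apply: (le_trans dE).
  rewrite -!mulrA ler_wpM2l //; apply: (le_trans (b_le _ _)).
  rewrite mulrA ler_wpM2r // ler_wpM2l ?(ltW Ki_gt0) //.
  by rewrite -{1}(subrK u0 (u h)) [leRHS]addrC ler_normD.
have : `|h| * Ki * `|d| <= be / 2 * `|d| by rewrite ler_wpM2r.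
have -> : `|h| * (2 * Ki / be * `|u0|) = 2 * (`|h| * Ki * `|u0|) / be.
  by field; rewrite gt_eqF.
rewrite ler_pdivlMr //; lra.
Qed.

Lemma measurement_is_derive :
  is_derive sigma (delta_mx i 0) (measurement b0 b W l r)
    (- b i (solution (form_sigma b0 b sigma) W l)
           (solution (form_sigma b0 b sigma) W r)).
Proof.
rewrite -/u0 -/w; set D := - b i u0 w.
pose q (h : R) := h^-1 *: ((measurement b0 b W l r \o shift sigma)
  (h *: delta_mx i 0) - measurement b0 b W l r sigma).
have qE (h : R) : h != 0 -> `|h| < sigma i 0 -> q h = - b i (u h) w.
  move=> h0 h_lt; rewrite /q /measurement /= -/(shifted h) -/(u h) -/u0.
  (* The increment lies in [W], so applying [r] to it amounts to pairing it with the adjoint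
     solution [w], which is also an admissible test vector in the increment equation. *)
  have rE : r (u h - u0) = - (h * b i (u h) w).
    rewrite -(solutionE sol_r (increment_in h_lt)) form_symC.
    exact: increment_form h_lt (solution_in sol_r).
  by rewrite -linearB rE -[_ *: _]/(_ * _) mulrN mulrA mulVf // mul1r.
suff q_cvg : q h @[h --> 0^'] --> D.
  by split; [apply/cvg_ex; exists D | exact/cvg_lim].
(* The difference quotient deviates from [D] by [b i (u h - u0) w] in absolute value; boundedness
   and [increment_le] estimate this by [K] times the size of [h]. *)
pose K := Ki * (2 * Ki / be * `|u0|) * `|w|.
have K_ge0 : 0 <= K by rewrite !mulr_ge0 ?invr_ge0 // ltW.
have K1_gt0 : 0 < K + 1 by rewrite ltr_wpDl.
apply/cvgrPdist_le => e e_gt0.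
near=> h.
have h0 : h != 0 by near: h; exact: nbhs_dnbhs_neq.
have h_lt : `|h| < sigma i 0.
  by near: h; apply: dnbhs0_lt; exact: sigma_gt0.
have hK : `|h| * Ki <= be / 2.
  rewrite -ler_pdivlMr //; near: h; apply: dnbhs0_le.
  by rewrite !divr_gt0.
have he : `|h| <= e / (K + 1).
  by near: h; apply: dnbhs0_le; rewrite divr_gt0.
rewrite qE // /D opprK addrC -linearBl /=; apply: (le_trans (b_le _ _)).
apply: (@le_trans _ _ (`|h| * K)).
  have -> : `|h| * K = Ki * (`|h| * (2 * Ki / be * `|u0|)) * `|w|.
    by rewrite /K; ring.
  rewrite ler_wpM2r // ler_wpM2l ?(ltW Ki_gt0) //.
  exact: increment_le.
apply: (@le_trans _ _ (`|h| * (K + 1))); first by rewrite ler_wpM2l ?lerDl.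
by rewrite -ler_pdivlMr.
Unshelve. all: by end_near.
Qed.

End Sensitivity.

(** Nonnegativity is stated for [r = l], where the error is the form on the diagonal: replacing [r]
    by its negative flips the sign of the error, so for a general pair the absolute value is
    estimated. *)
Theorem lemma4 (R : realType) (H : completeNormedModType R)
  (ip : {dot H for idfun}) (hip : norm_from_dot ip)
  (n : nat) (b0 : {symmetric H}) (b : 'I_n -> {symmetric H})
  (b0_bounded : bounded_form b0) (b_bounded : forall i, bounded_form (b i))
  (b0_psd : psd_form b0) (b_psd : forall i, psd_form (b i))
  (beta C : R) (beta_gt0 : 0 < beta) (C_gt0 : 0 < C)
  (b1_bounds : forall v : H,
     beta * `|v| ^+ 2 <= form_sigma b0 b (const_mx 1) v v <= C * `|v| ^+ 2)
  (Ci : 'I_n -> R) (Ci_gt0 : forall i, 0 < Ci i)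
  (b_le : forall i (u v : H), `|b i u v| <= Ci i * `|u| * `|v|)
  (V : set H) (hV : finite_dim_subspace V)
  (l r : {linear H -> R^o}) (l_cont : continuous l) (r_cont : continuous r)
  (sigma : 'cV[R]_n) (sigma_gt0 : pos_vec sigma) :
  let bs := form_sigma b0 b sigma in
  let ul := solution bs setT l in
  let ur := solution bs setT r in
  let tul := solution bs V l in
  let tur := solution bs V r in
  let calF := measurement b0 b setT in
  let F := measurement b0 b V in
  let Cs := cont_const C sigma in
  let betas := coer_const beta sigma in
  let dcalF i := partial i (calF l r) sigma in
  let dF i := partial i (F l r) sigma in
  [/\ calF l r sigma - F l r sigma = bs (ul - tul) (ur - tur),
      forall i : 'I_n,
        [/\ has_partial i (calF l r) sigma, has_partial i (F l r) sigma &
            dcalF i - dF i = b i tul (tur - ur) + b i (tul - ul) ur],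
      0 <= calF l l sigma - F l l sigma,
      `|calF l r sigma - F l r sigma| <= Cs * `|ul - tul| * `|ur - tur|
        <= Cs ^+ 3 / betas ^+ 2 * best_approx V ul * best_approx V ur &
      forall i : 'I_n,
        `|dcalF i - dF i|
          <= Ci i * `|tul| * `|tur - ur| + Ci i * `|ur| * `|tul - ul|
          <= Ci i * Cs / betas *
             (`|tul| * best_approx V ur + `|ur| * best_approx V ul)].
Proof.
move=> bs ul ur tul tur calF F Cs betas dcalF dF.
have V_sub := finite_dim_subspaceP hV.
have T_sub : subspace [set: H] by [].
have solT (k : {linear H -> R^o}) (k_cont : continuous k) tau :
    pos_vec tau -> solvable (form_sigma b0 b tau) setT k.
  by move=> tau_gt0; exact: (form_sigma_solvable b0_psd b_psd beta_gt0 C_gt0).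
have solV (k : {linear H -> R^o}) tau :
    pos_vec tau -> solvable (form_sigma b0 b tau) V k.
  move=> tau_gt0.
  exact: (form_sigma_finite_dim_solvable b0_psd b_psd beta_gt0 b1_bounds).
have betas_gt0 : 0 < betas := coer_const_gt0 beta_gt0 sigma_gt0.
have Cs_gt0 : 0 < Cs := cont_const_gt0 C_gt0 sigma.
have bs_coer v : betas * `|v| ^+ 2 <= bs v v.
  exact: (form_sigma_coercive b0_psd b_psd b1_bounds v sigma_gt0).
have bs_le u v : `|bs u v| <= Cs * `|u| * `|v|.
  exact: (form_sigma_bound b0_psd b_psd C_gt0 b1_bounds u v sigma_gt0).
have cea (k : {linear H -> R^o}) (k_cont : continuous k) :
    `|solution bs setT k - solution bs V k|
      <= Cs / betas * best_approx V (solution bs setT k).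
  exact: (Cea V_sub betas_gt0 Cs_gt0 bs_coer bs_le
    (solT k k_cont _ sigma_gt0) (solV k _ sigma_gt0)).
have diffE (k k' : {linear H -> R^o}) (k_cont : continuous k)
    (k'_cont : continuous k') : calF k k' sigma - F k k' sigma =
    bs (solution bs setT k - solution bs V k)
       (solution bs setT k' - solution bs V k').
  exact: (solution_diff_form (solT k k_cont _ sigma_gt0)
    (solV k _ sigma_gt0) (solT k' k'_cont _ sigma_gt0) (solV k' _ sigma_gt0)).
have dcalFE i : is_derive sigma (delta_mx i 0) (calF l r) (- b i ul ur).
  exact: (measurement_is_derive T_sub sigma_gt0 betas_gt0 (Ci_gt0 i) bs_coer
    (b_le i) (solT l l_cont) (solT r r_cont _ sigma_gt0)).
have dFE i : is_derive sigma (delta_mx i 0) (F l r) (- b i tul tur).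
  exact: (measurement_is_derive V_sub sigma_gt0 betas_gt0 (Ci_gt0 i) bs_coer
    (b_le i) (solV l) (solV r _ sigma_gt0)).
have dE i : dcalF i - dF i = b i tul (tur - ur) + b i (tul - ul) ur.
  (* Both sides equal [b i tul tur - b i ul ur]; on the right the mixed term [b i tul ur]
     cancels. *)
  rewrite /dcalF /dF /partial (@derive_val _ _ _ _ _ _ _ (dcalFE i)).
  rewrite (@derive_val _ _ _ _ _ _ _ (dFE i)) linearBr linearBl /=; ring.
have errl := cea l l_cont; have errr := cea r r_cont.
rewrite -/ul -/tul in errl; rewrite -/ur -/tur in errr.
split.
- exact: diffE.
- by move=> i; split; [exact: (@ex_derive _ _ _ _ _ _ _ (dcalFE i))|exact: (@ex_derive _ _ _ _ _ _ _ (dFE i))|].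
- by rewrite diffE //; apply: le_trans (bs_coer _); rewrite mulr_ge0 ?sqr_ge0 ?ltW.
- rewrite diffE // bs_le /=.
  (* One factor [Cs] comes from boundedness, and each of the two errors contributes [Cs / betas]
     through the Cea estimate. *)
  have -> : Cs ^+ 3 / betas ^+ 2 * best_approx V ul * best_approx V ur =
      Cs * ((Cs / betas * best_approx V ul) * (Cs / betas * best_approx V ur)).
    by field; rewrite gt_eqF.
  by rewrite -mulrA ler_wpM2l ?(ltW Cs_gt0) // ler_pM.
- move=> i; rewrite dE; apply/andP; split.
    apply: (le_trans (ler_normD _ _)); rewrite lerD //.
    by rewrite [Ci i * _ * _]mulrAC.
  have -> : Ci i * Cs / betas *
        (`|tul| * best_approx V ur + `|ur| * best_approx V ul) =
      Ci i * `|tul| * (Cs / betas * best_approx V ur) +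
      Ci i * `|ur| * (Cs / betas * best_approx V ul).
    by ring.
  by rewrite lerD // ler_wpM2l ?mulr_ge0 ?(ltW (Ci_gt0 i)) // distrC.
Qed.
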